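(* For $n \ge 2$, the discriminant of a random monic degree $n$ square-free polynomial over $F_q$ is equidistributed in $F_q^*$ between residues and nonresidues.
   Context: $F_q$ is the finite field with $q$ elements, and $F_q^*$ is its multiplicative group. A random monic degree $n$ square-free polynomial is one chosen uniformly at random from the finite set of all monic degree $n$ square-free polynomials with coefficients in $F_q$. A residue is an element of $F_q^*$ that is a square in $F_q^*$, and a nonresidue is an element of $F_q^*$ that is not. Equidistributed between residues and nonresidues means that the discriminant is a residue with the same probability that it is a nonresidue.
   Formalization: The formal statement assumes that q is odd; for even q every element of F_q^* is a square, so the discriminant is always a residue and the claim fails (e.g. q = 2, n = 2). *)

(* Defs.v *)
From HB Require Import structures.
From mathcomp Require Import all_boot all_order all_algebra.

Set Implicit Arguments.
Unset Strict Implicit.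
Unset Printing Implicit Defensive.

Import Order.TTheory GRing.Theory Num.Theory.

Local Open Scope ring_scope.

(* Only meant for monic p. The resultant of MathComp expands polynomials from
   low to high degree, so resultant q p is Res(p, q) = \prod_i q(a_i) for p
   monic with roots a_i; in this order no sign depends on the degree of p',
   which drops when the characteristic divides that of p. See discriminantE
   and map_discriminant. *)
Definition discriminant (F : fieldType) (p : {poly F}) : F :=
  (-1) ^+ 'C((size p).-1, 2) * resultant p^`() p.

(* Bounding the degree of g makes this decidable; see squarefreeP. *)
Definition squarefree (F : finFieldType) (p : {poly F}) : bool :=
  [forall g : {poly_(size p) F}, ((g : {poly F}) ^+ 2 %| p) ==> (size g == 1%N)].

Definition monic_squarefree (F : finFieldType) (n : nat) :
    {set {poly_n.+1 F}} :=
  [set f : {poly_n.+1 F} |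
    [&& (f : {poly F}) \is monic, size f == n.+1 & squarefree f]].

Definition residue (F : finFieldType) (x : F) : bool :=
  (x != 0) && [exists y : F, (y != 0) && (x == y ^+ 2)].

Definition nonresidue (F : finFieldType) (x : F) : bool :=
  (x != 0) && ~~ [exists y : F, (y != 0) && (x == y ^+ 2)].

(* Probability of E for an element drawn uniformly at random from A. *)
Definition unif_prob (T : finType) (A : {set T}) (E : pred T) : rat :=
  #|[set x in A | E x]|%:R / #|A|%:R.

Lemma squarefreeP (F : finFieldType) (p : {poly F}) : p != 0 ->
  reflect (forall g : {poly F}, g ^+ 2 %| p -> size g = 1%N) (squarefree p).
Proof.
move=> p0; apply: (iffP forallP) => [sf g gp | sf g]; last first.
  by apply/implyP => /sf ->.
have gs : (size g <= size p)%N.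
  by rewrite dvdp_leq // (dvdp_trans _ gp) // expr2 dvdp_mulr.
by have /implyP/(_ gp)/eqP := sf (NPoly (gs : g \is a poly_of_size (size p))).
Qed.

Lemma resultant_roots (F : fieldType) (n : nat) (a : 'I_n -> F) (g : {poly F}) :
  injective a ->
  resultant g (\prod_(i < n) ('X - (a i)%:P)) = \prod_(i < n) g.[a i].
Proof.
move=> inj_a; set p := \prod_(i < n) _.
have szp : size p = n.+1 by rewrite size_prod_XsubC /index_enum -enumT size_enum_ord.
have pm : p \is monic by rewrite monic_prod_XsubC.
have pa j : p.[a j] = 0.
  by rewrite horner_prod (bigD1 j) //= !hornerE subrr mul0r.
rewrite /resultant; set S := Sylvester_mx g p.
have SE := @Sylvester_mxE F g p; rewrite -/S /= in SE; move: S SE.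
rewrite szp /=; set m := (size g).-1 => S SE.
have szg : (size g <= m.+1)%N by rewrite leqSpred.
pose Va : 'M[F]_n := \matrix_(i, j) a j ^+ i.
pose W : 'M[F]_(n + m) :=
  block_mx Va 0 (\matrix_(i, j) a j ^+ (n + i)%N) 1%:M.
have evalW (r : {poly F}) (i : nat) j : (size r + i <= n + m)%N ->
    \sum_(k < n + m) (r`_(k - i)%N *+ (i <= k)%N) * a j ^+ k = a j ^+ i * r.[a j].
  move=> sz; have -> : a j ^+ i * r.[a j] = ('X^i * r).[a j].
    by rewrite hornerM hornerXn.
  rewrite (@horner_coef_wide _ (n + m)); last first.
    by rewrite (leq_trans (size_polyMleq _ _)) // size_polyXn addSn /= addnC.
  by apply: eq_bigr => k _; rewrite coefXnM ltnNge if_neg -mulrb.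
have WlE k (j : 'I_n) : W k (lshift m j) = a j ^+ k.
  by rewrite -[k]splitK; case: (split k) => k' /=;
    rewrite ?block_mxEul ?block_mxEdl mxE.
have WrE k (j : 'I_m) : W k (rshift n j) = (k == rshift n j)%:R.
  rewrite -[k]splitK; case: (split k) => k' /=.
    by rewrite block_mxEur mxE eq_lrshift.
  by rewrite block_mxEdr mxE eq_rshift.
have ul i j : (S *m W) (lshift m i) (lshift m j) = a j ^+ i * g.[a j].
  rewrite mxE -evalW; last first.
    rewrite (leq_trans (leq_add szg (leqnn i))) //.
    by rewrite addSnnS addnC leq_add2r ltn_ord.
  by apply: eq_bigr => k _; rewrite WlE SE -[lshift m i]/(unsplit (inl i)) unsplitK.
have dl i j : (S *m W) (rshift n i) (lshift m j) = 0.
  transitivity (a j ^+ i * p.[a j]); last by rewrite pa mulr0.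
  rewrite mxE -evalW; last first.
    by rewrite szp addSnnS leq_add2l ltn_ord.
  by apply: eq_bigr => k _; rewrite WlE SE -[rshift n i]/(unsplit (inr i)) unsplitK.
have dr i j : (S *m W) (rshift n i) (rshift n j) = p`_(n + j - i)%N *+ (i <= n + j)%N.
  rewrite mxE (bigD1 (rshift n j)) //= WrE eqxx mulr1 big1 => [|k /negPf kj].
    by rewrite addr0 SE -[rshift n i]/(unsplit (inr i)) unsplitK.
  by rewrite WrE kj mulr0.
have detW : \det W = \det Va by rewrite det_lblock det1 mulr1.
have detSW : \det (S *m W) = \det Va * \prod_i g.[a i].
  rewrite -[S *m W]submxK.
  have -> : dlsubmx (S *m W) = 0 by apply/matrixP => i j; rewrite !mxE -[RHS](dl i j) mxE.
  rewrite det_ublock.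
  have -> : ulsubmx (S *m W) = Va *m diag_mx (\row_i g.[a i]).
    by apply/matrixP => i j; rewrite mul_mx_diag 2![LHS]mxE ul !mxE.
  rewrite det_mulmx det_diag -[RHS]mulr1; congr (_ * _ * _).
    by apply: eq_bigr => i _; rewrite mxE.
  have dE i j : drsubmx (S *m W) i j = p`_(n + j - i)%N *+ (i <= n + j)%N.
    by rewrite 2!mxE dr.
  rewrite det_trig; last first.
    apply/is_trig_mxP => i j ij; rewrite dE nth_default ?mul0rn // szp.
    by rewrite ltn_subRL addnC ltn_add2l.
  apply: big1 => i _; rewrite dE leq_addl addnK mulr1n.
  by have := monicP pm; rewrite lead_coefE szp.
have Va0 : \det Va != 0.
  have -> : Va = Vandermonde n (\row_j a j) by apply/matrixP => i j; rewrite !mxE.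
  rewrite det_Vandermonde; apply/prodf_neq0 => i _; apply/prodf_neq0 => j ij.
  by rewrite !mxE subr_eq0; apply: contraTneq ij => /inj_a ->; rewrite ltnn.
by apply: (mulfI Va0); rewrite -detSW det_mulmx detW mulrC.
Qed.

Lemma discriminantE (F : fieldType) (n : nat) (a : 'I_n -> F) :
  discriminant (\prod_(i < n) ('X - (a i)%:P)) =
  \prod_(i < n) \prod_(j < n | (i < j)%N) (a i - a j) ^+ 2.
Proof.
set p := \prod_(i < n) _.
have szp : size p = n.+1 by rewrite size_prod_XsubC /index_enum -enumT size_enum_ord.
have dpE i : p^`().[a i] = \prod_(j < n | j != i) (a i - a j).
  rewrite /p (bigD1 i) //= derivM derivXsubC mul1r !hornerE subrr mul0r addr0.
  by rewrite horner_prod; apply: eq_bigr => j _; rewrite !hornerE.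
rewrite /discriminant szp /=.
have [/injectiveP inj_a | ] := boolP (injectiveb a); last first.
  case/injectivePn => i [j ij aij].
  have p0 : p != 0 by rewrite -size_poly_eq0 szp.
  have -> : resultant p^`() p = 0.
    apply/eqP; rewrite resultant_eq0.
    apply: (@root_size_gt1 _ (a i)); rewrite ?gcdp_eq0 ?(negPf p0) ?andbF //.
    rewrite root_gcd /root dpE (bigD1 j) 1?eq_sym //= aij subrr mul0r eqxx /=.
    by rewrite -aij horner_prod (bigD1 i) //= !hornerE subrr mul0r.
  rewrite mulr0; apply/esym/eqP.
  wlog lij : i j ij aij / (i < j)%N.
    by move=> W; have := ij; rewrite -val_eqE neq_ltn => /orP[]; apply: W; rewrite // eq_sym.
  by rewrite (bigD1 i) //= (bigD1 j) //= aij subrr expr0n /= !mul0r.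
rewrite resultant_roots //.
rewrite (eq_bigr _ (fun i _ => dpE i)).
under eq_bigr => i _ do rewrite (bigID (fun j : 'I_n => (i < j)%N)) /=.
rewrite big_split /= mulrCA.
have -> : (-1) ^+ 'C(n, 2) * (\prod_(i < n) \prod_(j < n | (j != i) &&
    ~~ (i < j)%N) (a i - a j)) = \prod_(i < n) \prod_(j < n | (i < j)%N) (a i - a j).
  rewrite [RHS](exchange_big_dep predT) //= -bin2_sum big_mkord.
  rewrite -prodrXr -big_split /=; apply: eq_bigr => i _.
  have -> : \prod_(j < n | (j < i)%N) (a j - a i) =
            (-1) ^+ i * \prod_(j < n | (j < i)%N) (a i - a j).
    under eq_bigr => j _ do rewrite -opprB.
    rewrite prodrN; congr ((-1) ^+ _ * _).
    by rewrite -sum1_card (big_ord_narrow (ltnW (ltn_ord i))) sum1_card card_ord.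
  congr (_ * _); apply: eq_bigl => j.
  by rewrite -leqNgt ltn_neqAle val_eqE.
rewrite -big_split /=; apply: eq_bigr => i _; rewrite prodrXl expr2.
congr (_ * _); apply: eq_bigl => j.
by rewrite andb_idl // -val_eqE => /gtn_eqF ->.
Qed.

Lemma map_discriminant (F L : fieldType) (f : {rmorphism F -> L})
    (p : {poly F}) :
  discriminant (map_poly f p) = f (discriminant p).
Proof.
rewrite /discriminant size_map_poly rmorphM rmorphXn rmorphN1; congr (_ * _).
rewrite deriv_map /resultant /Sylvester_mx !size_map_poly -det_map_mx /=.
rewrite map_col_mx; congr (\det (col_mx _ _));
  by apply/esym/map_lin1_mx => v; rewrite /= map_poly_rV rmorphM /= map_rVpoly.
Qed.

(* Main.v *)
Require Import Defs.
From HB Require Import structures.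
From mathcomp Require Import all_boot all_order all_algebra all_field.

Set Implicit Arguments.
Unset Strict Implicit.
Unset Printing Implicit Defensive.

Import GRing.Theory Num.Theory.

Local Open Scope ring_scope.

(** The statement is that the quadratic character chi of the discriminant sums
    to 0 over the monic f of degree n, those that are not square-free
    contributing chi(0) = 0 (discriminant_neq0_sqr). The sum is
    evaluated by recognizing pellet(f) = (-1)^(deg f) chi(disc f) as the Moebius
    function.

    Over an algebraically closed field containing F, let f have roots s. The
    Vandermonde product of s is a square root of disc f, so disc f is a square
    in F if and only if the Frobenius x |-> x^q fixes it (pellet_roots); in
    general Frobenius multiplies it by the sign of the permutation that it
    induces on s. Hence pellet is multiplicative on coprime polynomials
    (pelletM), vanishes on multiples of the square of a nonconstant polynomial
    (pellet_sqr_dvd), and equals -1 on a polynomial whose roots form one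
    Frobenius orbit. Such a polynomial behaves as a prime, and every nonconstant
    f has one as a factor (pellet_prime_factor).

    These properties make the sum of pellet over the monic divisors of a
    nonconstant f vanish (sum_divisors_pellet). Summing this over f of given
    degree yields a recursion on the sums M_k of pellet over the monic
    polynomials of degree k which, with M_0 = 1, is equivalent to
    sum_k M_k u^k = 1 - q u; in particular M_n = 0 for n >= 2 (sum_pellet). *)

(** * The Vandermonde product of a sequence *)

(** The product of the differences s_i - s_j over i < j: a square root of the
    discriminant of the monic polynomial whose roots are listed by s. *)
Fixpoint vdm (R : comNzRingType) (s : seq R) : R :=
  if s is x :: s' then (\prod_(y <- s') (x - y)) * vdm s' else 1.

Lemma vdm_cat (R : comNzRingType) (s t : seq R) :
  vdm (s ++ t) = vdm s * vdm t * \prod_(x <- s) \prod_(y <- t) (x - y).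
Proof.
elim: s => [|x s IHs] /=; first by rewrite big_nil mul1r mulr1.
rewrite IHs big_cons big_cat /= -!mulrA; congr (_ * _).
by rewrite mulrCA; congr (_ * _); rewrite mulrCA.
Qed.

(** Rotating a sequence by one step is a cycle, of sign (-1)^(length - 1). *)
Lemma vdm_rcons (R : comNzRingType) (x : R) (s : seq R) :
  vdm (rcons s x) = (-1) ^+ size s * vdm (x :: s).
Proof.
rewrite -cats1 vdm_cat /= big_nil !mulr1 [LHS]mulrC mulrA; congr (_ * _).
elim: s => [|y s IHs]; first by rewrite !big_nil mulr1.
by rewrite !big_cons big_nil IHs mulr1 exprS mulrACA mulN1r opprB.
Qed.

Lemma rmorph_vdm (R S : comNzRingType) (f : {rmorphism R -> S}) (s : seq R) :
  f (vdm s) = vdm (map f s).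
Proof.
elim: s => [|x s IHs] /=; first exact: rmorph1.
rewrite rmorphM IHs rmorph_prod big_map; congr (_ * _).
by apply: eq_bigr => y _; rewrite rmorphB.
Qed.

Lemma vdm_neq0 (R : idomainType) (s : seq R) : (vdm s != 0) = uniq s.
Proof.
elim: s => [|x s IHs] /=; first exact: oner_neq0.
rewrite mulf_eq0 negb_or IHs; congr (_ && _).
elim: s {IHs} => [|y s IHs]; first by rewrite big_nil oner_eq0.
by rewrite big_cons mulf_eq0 negb_or IHs inE negb_or subr_eq0.
Qed.

Lemma vdmE (R : comNzRingType) (s : seq R) :
  vdm s = \prod_(i < size s) \prod_(j < size s | (i < j)%N) (s`_i - s`_j).
Proof.
elim: s => [|x s IHs] /=; first by rewrite big_ord0.
rewrite big_ord_recl /= [in RHS]big_mkcond big_ord_recl /= mul1r IHs; congr (_ * _).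
  by rewrite (big_nth 0) big_mkord.
by apply: eq_bigr => i _; rewrite [RHS]big_mkcond big_ord_recl /= mul1r -big_mkcond.
Qed.

Lemma discriminant_prod_XsubC (F : fieldType) (s : seq F) :
  discriminant (\prod_(x <- s) ('X - x%:P)) = vdm s ^+ 2.
Proof.
rewrite (big_nth 0) big_mkord (@discriminantE _ _ (fun i => s`_i)) vdmE.
by rewrite -prodrXl; apply: eq_bigr => i _; rewrite prodrXl.
Qed.

(** A square factor g^2 of p makes g a common factor of p and p', which kills
    their resultant. *)
Lemma discriminant_neq0_sqr (F : fieldType) (p g : {poly F}) :
  discriminant p != 0 -> p != 0 -> g ^+ 2 %| p -> size g = 1%N.
Proof.
rewrite /discriminant mulf_eq0 signr_eq0 /= resultant_eq0 -leqNgt => cop p0.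
case/dvdpP => h ph; have g0 : g != 0.
  by apply: contra_neq p0 => g0; rewrite ph g0 expr2 !mulr0.
have gd : g %| gcdp p^`() p.
  rewrite dvdp_gcd; apply/andP; split; last by rewrite ph expr2 mulrA dvdp_mulIr.
  rewrite ph expr2 !derivM; apply: dvdp_add; apply: dvdp_mull; first exact: dvdp_mulIl.
  by apply: dvdp_add; [apply: dvdp_mulIr | apply: dvdp_mulIl].
apply/eqP; rewrite eqn_leq size_poly_gt0 g0 andbT (leq_trans _ cop) //.
by apply: dvdp_leq => //; rewrite gcdp_eq0 (negPf p0) andbF.
Qed.

(** * The quadratic character of the discriminant *)

Definition quadratic_char (F : finFieldType) (x : F) : int :=
  (residue x)%:R - (nonresidue x)%:R.

Lemma quadratic_char0 (F : finFieldType) : quadratic_char (0 : F) = 0.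
Proof. by rewrite /quadratic_char /residue /nonresidue eqxx. Qed.

(** By the theorem of Pellet and Stickelberger this is the Moebius function of
    monic polynomials when #|F| is odd. Starting from the discriminant
    dispenses with factorizations into irreducibles. *)
Definition pellet (F : finFieldType) (f : {poly F}) : int :=
  (-1) ^+ (size f).-1 * quadratic_char (discriminant f).

(** * Frobenius acting on roots in an algebraically closed field *)

Section Frobenius.

Variables (F : finFieldType) (K : closedFieldType) (iota : {rmorphism F -> K}).

(** The embedding is an argument because it is what makes this power map
    additive: it fixes the characteristic of K. *)
Definition frob of {rmorphism F -> K} : K -> K := fun x => x ^+ #|F|.

Local Notation phi := (frob iota).

Fact frob_is_zmod_morphism : zmod_morphism phi.
Proof.
move=> x y; rewrite /frob; have [p p_pr pcharF] := finPcharP F.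
have pcharK : p \in [pchar K] by rewrite (fmorph_pchar iota).
rewrite (card_pprimeChar pcharF).
elim: (logn _ _) => // n IHn; rewrite expnSr !exprM {}IHn.
by rewrite -(pFrobenius_autE pcharK) rmorphB.
Qed.

Fact frob_is_monoid_morphism : monoid_morphism phi.
Proof. by rewrite /frob; split=> [|x y]; rewrite ?exprMn ?expr1n. Qed.

HB.instance Definition _ :=
  GRing.isZmodMorphism.Build K K phi frob_is_zmod_morphism.
HB.instance Definition _ :=
  GRing.isMonoidMorphism.Build K K phi frob_is_monoid_morphism.

(** The elements of F are #|F| roots of X^#|F| - X, hence all of them. *)
Lemma frob_fixed (x : K) : reflect (exists y, x = iota y) (phi x == x).
Proof.
have := congr1 (map_poly iota) (finField_genPoly F).
rewrite rmorphB /= map_polyXn map_polyX rmorph_prod => /(congr1 (horner^~ x)).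
rewrite !hornerE horner_prod => E.
rewrite -subr_eq0 /frob E; apply: (iffP (prodf_eq0 _ _)) => [[y _]|[y ->]].
  by rewrite rmorphB /= map_polyX map_polyC !hornerE subr_eq0 => /eqP ->; exists y.
by exists y; rewrite // rmorphB /= map_polyX map_polyC !hornerE subrr.
Qed.

Lemma frob_id (y : F) : phi (iota y) = iota y.
Proof. by apply/eqP/frob_fixed; exists y. Qed.

Lemma frob_horner (f : {poly F}) (x : K) :
  phi (map_poly iota f).[x] = (map_poly iota f).[phi x].
Proof.
rewrite -horner_map -map_poly_comp; congr (_.[_]).
by apply: eq_map_poly => y; exact: frob_id.
Qed.

Lemma frob_perm_roots (f : {poly F}) (s : seq K) :
  uniq s -> map_poly iota f = \prod_(x <- s) ('X - x%:P) ->
  perm_eq (map phi s) s.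
Proof.
move=> us fs; have um : uniq (map phi s) by rewrite map_inj_uniq //; exact: fmorph_inj.
have sub : {subset map phi s <= s}.
  move=> _ /mapP[x xs ->]; rewrite -root_prod_XsubC -fs rootE -frob_horner.
  by move: xs; rewrite -root_prod_XsubC -fs => /rootP ->; rewrite rmorph0.
by apply: uniq_perm => //; case: (uniq_min_size um sub); rewrite ?size_map.
Qed.

(** Frobenius fixes the coefficients of a product over a set that it permutes,
    so they come from F. *)
Lemma frob_descent (s : seq K) : perm_eq (map phi s) s ->
  exists f : {poly F}, map_poly iota f = \prod_(x <- s) ('X - x%:P).
Proof.
move=> ps; set p := \prod_(x <- s) _.
have pK : map_poly phi p = p.
  rewrite /p rmorph_prod -[RHS](perm_big _ ps) big_map /=.
  by apply: eq_bigr => x _; rewrite rmorphB /= map_polyX map_polyC.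
have /fin_all_exists [c cE] (i : 'I_(size p)) : exists y, p`_i = iota y.
  by apply/frob_fixed; rewrite -coef_map [map_poly _ _]pK.
exists (\poly_(i < size p) if insub i is Some j then c j else 0).
apply/polyP => i; rewrite coef_map coef_poly.
case: insubP => [j -> <-|/negPf ip]; first by rewrite cE.
by rewrite ip /= rmorph0 nth_default // leqNgt ip.
Qed.

(** The iterates of x are all roots of f, so they cannot stay distinct; as
    Frobenius is injective, the first repetition is a return to x. *)
Lemma frob_orbit (f : {poly F}) (x : K) : f != 0 -> root (map_poly iota f) x ->
  exists n, uniq (traject phi x n.+1) /\
    map phi (traject phi x n.+1) = rcons (traject phi (phi x) n) x.
Proof.
move=> f0 fx; have [r fr] := closed_field_poly_normal (map_poly iota f).
have rootr y : root (map_poly iota f) y = (y \in r).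
  by rewrite fr rootZ ?root_prod_XsubC // lead_coef_eq0 map_poly_eq0.
have loop_r : looping phi x (size r).
  apply: contraT; rewrite -looping_uniq => ut.
  suff /(uniq_leq_size ut) : {subset traject phi x (size r).+1 <= r}.
    by rewrite size_traject ltnn.
  move=> _ /trajectP[i _ ->]; rewrite -rootr.
  elim: i => //= i /rootP fi; apply/rootP.
  by rewrite -frob_horner fi rmorph0.
case: (ex_minnP (ex_intro (fun n => looping phi x n) _ loop_r)) => -[|n] //.
move=> loop_n min_n.
have ut : uniq (traject phi x n.+1).
  by rewrite looping_uniq; apply/negP => /min_n; rewrite ltnn.
exists n; split=> //.
have map_traject m y : map phi (traject phi y m) = traject phi (phi y) m.
  by elim: m y => //= m IHm y; rewrite IHm.
rewrite map_traject trajectSr -iterSr; congr (rcons _ _).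
have /trajectP[[|i] // lt_i_n] := loop_n.
move=> /(fmorph_inj phi) xi; suff /min_n : looping phi x n by rewrite ltnn.
by apply/trajectP; exists i.
Qed.

Hypothesis q_odd : odd #|F|.

Lemma odd_card_oppr_neq (y : K) : y != 0 -> - y != y.
Proof.
move=> y0; rewrite eq_sym -subr_eq0 opprK -mulr2n -mulr_natl mulf_eq0 negb_or y0 andbT.
rewrite -(rmorph_nat iota) fmorph_eq0; apply/negP => two0.
have pchar2 : 2 \in [pchar F] by rewrite inE two0.
move: q_odd (finNzRing_gt1 F); rewrite (card_pprimeChar pchar2) oddX orbF.
by move=> /eqP ->.
Qed.

(** The square roots of x in K are y and -y, and these differ; so x is a square
    in F exactly when Frobenius fixes y. *)
Lemma quadratic_char_sqr (x : F) (y : K) (b : bool) : y != 0 -> iota x = y ^+ 2 ->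
  phi y = (-1) ^+ b * y -> quadratic_char x = (-1) ^+ b.
Proof.
move=> y0 xy yb; have x0 : x != 0 by rewrite -(fmorph_eq0 iota) xy expf_neq0.
rewrite /quadratic_char /residue /nonresidue x0 /=.
suff -> : [exists z, (z != 0) && (x == z ^+ 2)] = ~~ b by case: (b).
case: b yb => [|] /= yb.
  apply/existsP => -[z /andP[_ /eqP xz]].
  suff /eqP phiy : phi y == y.
    by have := odd_card_oppr_neq y0; rewrite -mulN1r -yb phiy eqxx.
  have: iota z ^+ 2 == y ^+ 2 by rewrite -xy xz rmorphXn.
  rewrite eqf_sqr => /orP[] /eqP zy; apply/frob_fixed; first by exists z.
  by exists (- z); rewrite rmorphN zy opprK.
have /frob_fixed[z yz] : phi y == y by rewrite yb mul1r.
apply/existsP; exists z; rewrite -(fmorph_eq0 iota) -yz y0 /=.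
by rewrite -(inj_eq (fmorph_inj iota)) rmorphXn /= -yz xy.
Qed.

Lemma frob_sqrt (x : F) (y : K) : iota x = y ^+ 2 ->
  exists b : bool, phi y = (-1) ^+ b * y.
Proof.
move=> xy; have: phi y ^+ 2 == y ^+ 2 by rewrite -rmorphXn /= -xy frob_id.
rewrite eqf_sqr => /orP[] /eqP ->; first by exists false; rewrite mul1r.
by exists true; rewrite mulN1r.
Qed.

Lemma discriminant_roots (f : {poly F}) (s : seq K) :
  map_poly iota f = \prod_(x <- s) ('X - x%:P) ->
  iota (discriminant f) = vdm s ^+ 2.
Proof. by move=> fs; rewrite -map_discriminant fs discriminant_prod_XsubC. Qed.

(** Stickelberger's criterion: vdm s is a square root of the discriminant, so
    the sign by which Frobenius acts on it is the quadratic character. *)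
Lemma pellet_roots (f : {poly F}) (s : seq K) (b : bool) :
  map_poly iota f = \prod_(x <- s) ('X - x%:P) -> uniq s ->
  phi (vdm s) = (-1) ^+ b * vdm s -> pellet f = (-1) ^+ (size s + b).
Proof.
move=> fs us sb; rewrite exprD /pellet -(size_map_poly iota) fs size_prod_XsubC.
congr (_ * _); apply: quadratic_char_sqr sb; last exact: discriminant_roots.
by rewrite vdm_neq0.
Qed.

Lemma pellet_nonuniq (f : {poly F}) (s : seq K) :
  map_poly iota f = \prod_(x <- s) ('X - x%:P) -> ~~ uniq s -> pellet f = 0.
Proof.
move=> fs us; suff /eqP f0 : discriminant f == 0.
  by rewrite /pellet f0 quadratic_char0 mulr0.
rewrite -(fmorph_eq0 iota) (discriminant_roots fs).
by move: us; rewrite -vdm_neq0 negbK => /eqP ->; rewrite expr0n.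
Qed.

Lemma monic_roots (f : {poly F}) : f \is monic ->
  exists s : seq K, map_poly iota f = \prod_(x <- s) ('X - x%:P).
Proof.
move=> fm; have [s fs] := closed_field_poly_normal (map_poly iota f).
by exists s; rewrite [LHS]fs lead_coef_map (monicP fm) rmorph1 scale1r.
Qed.

(** The Vandermonde product of the joint roots is the product of those of f and
    g with the differences x - y of a root of f and a root of g. The product of
    these is fixed by Frobenius, which permutes the roots of f and those of g;
    hence the signs multiply. *)
Lemma pelletM_closed (f g : {poly F}) : f \is monic -> g \is monic -> coprimep f g ->
  pellet (f * g) = pellet f * pellet g.
Proof.
move=> /monic_roots[s fs] /monic_roots[t gt] cfg.
have fgst : map_poly iota (f * g) = \prod_(x <- s ++ t) ('X - x%:P).
  by rewrite rmorphM /= fs gt big_cat.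
have [us|us] := boolP (uniq s); last first.
  rewrite (pellet_nonuniq fs us) mul0r (pellet_nonuniq fgst) //.
  by rewrite cat_uniq (negPf us).
have [ut|ut] := boolP (uniq t); last first.
  rewrite (pellet_nonuniq gt ut) mulr0 (pellet_nonuniq fgst) //.
  by rewrite cat_uniq (negPf ut) !andbF.
have ust : uniq (s ++ t).
  rewrite cat_uniq us ut andbT /=; apply/hasPn => x xt; apply/negP => xs.
  have: coprimep (map_poly iota f) (map_poly iota g) by rewrite coprimep_map.
  move=> /coprimep_root; rewrite fs => /(_ x).
  by rewrite root_prod_XsubC xs gt -rootE root_prod_XsubC xt => /(_ isT).
have [b sb] := frob_sqrt (discriminant_roots fs).
have [c tc] := frob_sqrt (discriminant_roots gt).
have phiR : phi (\prod_(x <- s) \prod_(y <- t) (x - y)) =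
            \prod_(x <- s) \prod_(y <- t) (x - y).
  rewrite rmorph_prod -[RHS](perm_big _ (frob_perm_roots us fs)) big_map.
  apply: eq_bigr => x _.
  rewrite rmorph_prod -[RHS](perm_big _ (frob_perm_roots ut gt)) big_map.
  by apply: eq_bigr => y _; rewrite rmorphB.
rewrite (pellet_roots fs us sb) (pellet_roots gt ut tc).
rewrite (@pellet_roots _ _ (b (+) c) fgst ust).
  rewrite size_cat !exprD -mulrACA; congr (_ * _).
  by rewrite signr_addb.
by rewrite vdm_cat !rmorphM /= phiR sb tc signr_addb mulrACA -!mulrA.
Qed.

(** Take for p the polynomial whose roots form the Frobenius orbit of one root
    x of f. A g over F that vanishes somewhere on the orbit vanishes on all of
    it, which is the dichotomy. Frobenius is a cycle on the orbit, of sign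
    (-1)^(deg p - 1), so the sign (-1)^(deg p) leaves -1. *)
Lemma pellet_prime_factor_closed (f : {poly F}) : (1 < size f)%N ->
  exists p : {poly F}, [/\ p \is monic, (1 < size p)%N, p %| f, pellet p = -1 &
    forall g, (p %| g) || coprimep p g].
Proof.
move=> f1; have f0 : f != 0 by rewrite -size_poly_gt0 ltnW.
have /closed_rootP[x fx] : size (map_poly iota f) != 1%N.
  by rewrite size_map_poly gtn_eqF.
have [n] := frob_orbit f0 fx; rewrite trajectS; set s := traject _ _ _ => -[us ms].
have perms : perm_eq (map phi (x :: s)) (x :: s) by rewrite ms perm_rcons.
have [p ps] := frob_descent perms.
have szp : size p = n.+2.
  by rewrite -(size_map_poly iota) ps size_prod_XsubC /= size_traject.
have pdvd g : root (map_poly iota g) x -> p %| g.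
  move=> gx; rewrite -(dvdp_map iota) ps uniq_roots_dvdp ?uniq_rootsE //.
  apply/allP => y; rewrite -[x :: s]/(traject phi x n.+1) => /trajectP[i _ ->].
  elim: i => //= i /rootP gi; apply/rootP.
  by rewrite -frob_horner gi rmorph0.
exists p; split.
- by rewrite -(map_monic iota) ps monic_prod_XsubC.
- by rewrite szp.
- exact: pdvd.
- rewrite (@pellet_roots p (x :: s) (odd n) ps us).
    by rewrite /= size_traject addSn exprS exprD signr_odd -expr2 sqrr_sign mulr1.
  by rewrite rmorph_vdm ms vdm_rcons size_traject signr_odd.
- move=> g; apply/orP; have [d1|d1] := eqVneq (size (gcdp p g)) 1%N.
    by right; rewrite /coprimep d1.
  left; have /closed_rootP[y] : size (map_poly iota (gcdp p g)) != 1%N.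
    by rewrite size_map_poly.
  rewrite gcdp_map root_gcd ps root_prod_XsubC => /andP[].
  rewrite -[x :: s]/(traject phi x n.+1) => /trajectP[i lei ->] gy.
  (* x is reached by going once around the orbit, starting from a common root. *)
  apply: pdvd; have <- : iter (n.+1 - i) phi (iter i phi x) = x.
    rewrite -iterD subnK; last exact: ltnW.
    have := congr1 (last x) ms.
    by rewrite last_rcons /= last_map last_traject.
  elim: (n.+1 - i)%N => //= m /rootP gm; apply/rootP.
  by rewrite -frob_horner gm rmorph0.
Qed.

End Frobenius.

(** * Moebius inversion *)

Lemma pelletM (F : finFieldType) (f g : {poly F}) : odd #|F| ->
  f \is monic -> g \is monic -> coprimep f g ->
  pellet (f * g) = pellet f * pellet g.
Proof.
have [K [iota _]] := countable_algebraic_closure F.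
by move=> q_odd; exact: (pelletM_closed iota).
Qed.

Lemma pellet_prime_factor (F : finFieldType) (f : {poly F}) : odd #|F| ->
  (1 < size f)%N ->
  exists p : {poly F}, [/\ p \is monic, (1 < size p)%N, p %| f, pellet p = -1 &
    forall g, (p %| g) || coprimep p g].
Proof.
have [K [iota _]] := countable_algebraic_closure F.
by move=> q_odd; exact: (pellet_prime_factor_closed iota).
Qed.

Lemma pellet_sqr_dvd (F : finFieldType) (f g : {poly F}) :
  f != 0 -> (1 < size g)%N -> g ^+ 2 %| f -> pellet f = 0.
Proof.
move=> f0 g1 gf; have [d0|d0] := eqVneq (discriminant f) 0.
  by rewrite /pellet d0 quadratic_char0 mulr0.
by move: g1; rewrite (discriminant_neq0_sqr d0 f0 gf).
Qed.

Section DivisorSums.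

Variables (F : finFieldType) (N : nat).

(** For p a prime factor of f, a divisor d prime to p cancels against p * d, and
    the divisors that are multiples of p^2 contribute 0. *)
Lemma sum_divisors_pellet (f : {poly F}) : odd #|F| ->
  f \is monic -> (1 < size f <= N)%N ->
  \sum_(d : {poly_N F} | ((d : {poly F}) \is monic) && ((d : {poly F}) %| f))
     pellet d = 0.
Proof.
move=> q_odd fm /andP[f1 fN]; have [p [pm p1 pf pp pdvd]] := pellet_prime_factor q_odd f1.
have f0 : f != 0 := monic_neq0 fm; have p0 : p != 0 := monic_neq0 pm.
have sz_dvd (g : {poly F}) : g %| f -> (size g <= N)%N.
  by move=> gf; apply: leq_trans fN; exact: dvdp_leq.
rewrite (bigID (fun d : {poly_N F} => p %| d)) /=.
rewrite (bigID (fun d : {poly_N F} => p ^+ 2 %| d)) /= big1 ?add0r; last first.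
  move=> d /andP[/andP[/andP[dm _] _]]; apply: pellet_sqr_dvd p1.
  exact: monic_neq0.
rewrite (reindex_onto (fun d : {poly_N F} => npolyp N (p * d))
                      (fun d : {poly_N F} => npolyp N (d %/ p))) /=; last first.
  move=> d /andP[/andP[/andP[dm df] pd] _]; apply: val_inj => /=.
  have dN : (size (d %/ p)%R <= N)%N.
    by rewrite (leq_trans (leq_divp _ _)) ?size_npoly.
  by rewrite npolypK npolypK ?[p * _]mulrC ?divpK ?size_npoly.
apply/eqP; rewrite addr_eq0 -sumrN; apply/eqP.
rewrite [LHS](eq_bigl (fun d : {poly_N F} =>
  ((d : {poly F}) \is monic) && ((d : {poly F}) %| f) && ~~ (p %| d))).
  apply: eq_bigr => d /andP[/andP[dm df] pd].
  have cpd : coprimep p d by have := pdvd d; rewrite (negPf pd).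
  rewrite npolypK; last by apply: sz_dvd; rewrite Gauss_dvdp // pf.
  by rewrite pelletM // pp mulN1r.
move=> d; apply/idP/idP => [/andP[/andP[/andP[/andP[m1 d1] d2] d3] /eqP dK]|].
- have sd : (size (npolyp N (p * d) %/ p)%R <= N)%N.
    by rewrite (leq_trans (leq_divp _ _)) ?size_npoly.
  have dE : npolyp N (p * d) = p * d :> {poly F}.
    have dq : d = npolyp N (p * d) %/ p :> {poly F} by rewrite -[RHS](npolypK sd) dK.
    by rewrite [in RHS]dq [RHS]mulrC divpK.
  move: m1 d1 d3; rewrite dE monicMl // => -> /(dvdp_trans (dvdp_mull _ (dvdpp _))) -> /=.
  by rewrite expr2 dvdp_mul2l.
move=> /andP[/andP[dm df] pd].
have cpd : coprimep p d by have := pdvd d; rewrite (negPf pd).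
have pdf : p * d %| f by rewrite Gauss_dvdp // pf.
rewrite npolypK ?sz_dvd // monicMl // dm pdf dvdp_mulIl expr2 dvdp_mul2l // pd /=.
by apply/eqP/val_inj; rewrite /= npolypK mulKp ?size_npoly.
Qed.

(** The cofactors of d are the X^m + r with r of degree less than
    m = n - deg d. *)
Lemma card_monic_multiples (d : {poly F}) (n : nat) : (n < N)%N ->
  d \is monic -> (size d <= n.+1)%N ->
  #|[set f : {poly_N F} | [&& (f : {poly F}) \is monic, size f == n.+1 &
      d %| f]]| = (#|F| ^ (n.+1 - size d))%N.
Proof.
move=> nN dm dn; set m := (n.+1 - size d)%N; rewrite -(@card_npoly F m).
have d0 := monic_neq0 dm.
have szX (r : {poly_m F}) : (size (r : {poly F}) < size ('X^m : {poly F}))%N.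
  by rewrite size_polyXn ltnS size_npoly.
have monX (r : {poly_m F}) : 'X^m + (r : {poly F}) \is monic.
  by rewrite monicE lead_coefDl // lead_coefXn.
have szdX (r : {poly_m F}) : size (d * ('X^m + (r : {poly F}))) = n.+1.
  rewrite size_Mmonic ?monic_neq0 // size_polyDl // size_polyXn addnS /= addnC.
  exact: subnK.
pose h (r : {poly_m F}) := npolyp N (d * ('X^m + (r : {poly F}))).
have hE r : h r = d * ('X^m + (r : {poly F})) :> {poly F}.
  by rewrite npolypK // szdX.
rewrite -(@card_imset _ _ h); last first.
  move=> r1 r2 /(congr1 (@polyn _ _)); rewrite !hE => /(mulfI d0) /addrI.
  exact: val_inj.
congr #|pred_of_set _|; apply/setP => f; rewrite inE; apply/and3P/imsetP.
  case=> fm /eqP fs /dvdpP[g fg].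
  have gm : g \is monic by rewrite -(monicMr _ dm) -fg.
  have gs : size g = m.+1.
    move: fs; rewrite fg size_Mmonic ?monic_neq0 // => fs.
    rewrite /m -fs; have := monic_neq0 gm; rewrite -size_poly_gt0 => gp.
    by rewrite -subn1 -addnBAC // addnK subn1 prednK.
  have rs : (size (g - 'X^m)%R <= m)%N.
    apply/leq_sizeP => j; rewrite leq_eqVlt coefB coefXn => /orP[/eqP <-|mj].
      by rewrite eqxx -[m]/(m.+1.-1) -gs -lead_coefE (monicP gm) subrr.
    by rewrite nth_default ?gs // gtn_eqF // subr0.
  exists (npolyp m (g - 'X^m)) => //; apply: val_inj => /=.
  by rewrite hE npolypK // addrC subrK mulrC.
move=> [r _ ->]; rewrite hE; split.
- by rewrite monicMl.
- by rewrite szdX.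
- exact: dvdp_mulIl.
Qed.

(** Let c_k(d) be the number of monic multiples of d of degree k. Summing
    sum_divisors_pellet over the monic f of degree k gives
    sum_d pellet(d) c_k(d) = 0 for every k >= 1. As c_n(d) = q c_(n-1)(d) for
    deg d <> n, subtracting q times the identity for k = n - 1, which needs
    n >= 2, leaves only the d of degree n, each counted once. *)
Lemma sum_pellet (n : nat) : odd #|F| -> (2 <= n < N)%N ->
  \sum_(f : {poly_N F} | ((f : {poly F}) \is monic) && (size f == n.+1))
    pellet f = 0.
Proof.
move=> q_odd /andP[n2 nN].
pose c k (d : {poly F}) : int := #|[set f : {poly_N F} |
  [&& (f : {poly F}) \is monic, size f == k.+1 & d %| f]]|%:R.
have c0 k (d : {poly F}) : (k.+1 < size d)%N -> c k d = 0.
  move=> kd; rewrite /c (_ : [set f | _] = set0) ?cards0 //.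
  apply/setP => f; rewrite !inE; apply/and3P => -[fm /eqP fs df].
  by have := dvdp_leq (monic_neq0 fm) df; rewrite fs leqNgt kd.
(* The pairs (d, f) with d dividing f, summed by d; summed by f they cancel. *)
have convolution k : (1 <= k < N)%N ->
    \sum_(d : {poly_N F} | (d : {poly F}) \is monic) pellet d * c k d = 0.
  move=> /andP[k1 kN].
  rewrite [LHS](_ : _ = \sum_(f : {poly_N F} | ((f : {poly F}) \is monic) && (size f == k.+1))
    \sum_(d : {poly_N F} | ((d : {poly F}) \is monic) && ((d : {poly F}) %| f))
     pellet d); last first.
    rewrite (exchange_big_dep (fun d : {poly_N F} => (d : {poly F}) \is monic)) /=.
      apply: eq_bigr => d dm; rewrite /c -sum1_card natr_sum mulr_sumr.
      apply: eq_big => [f|f _]; last by rewrite mulr1.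
      by rewrite inE dm -andbA.
    by move=> f d _ /andP[].
  apply: big1 => f /andP[fm /eqP fs].
  by apply: sum_divisors_pellet => //; rewrite fs ltnS k1.
case: n n2 nN => // n n2 nN.
(* Here n.+1 is the degree of the f in the sum to be evaluated. For d of exactly
   that degree the left side is 1 and the right side 0. *)
have cS (d : {poly F}) : d \is monic -> size d != n.+2 ->
    c n.+1 d = #|F|%:R * c n d.
  move=> dm; rewrite neq_ltn => /orP[ds|ds].
    rewrite /c !card_monic_multiples // ?(ltnW ds) //; last exact: ltnW.
    by rewrite subSn // expnS natrM.
  by rewrite !c0 ?mulr0 // ltnW.
(* By cS this part is q times the convolution identity one degree lower, which
   is available because that degree is still positive. *)
have rest0 : \sum_(d : {poly_N F} | ((d : {poly F}) \is monic) &&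
    (size d != n.+2)) pellet d * c n.+1 d = 0.
  rewrite (eq_bigr (fun d : {poly_N F} => #|F|%:R * (pellet d * c n d))); last first.
    by move=> d /andP[dm ds]; rewrite cS // mulrCA.
  rewrite -mulr_sumr; have := convolution n; rewrite (ltnW nN) andbT => /(_ n2).
  rewrite (bigID (fun d : {poly_N F} => size d == n.+2)) /= big1 ?add0r.
    by move=> ->; rewrite mulr0.
  by move=> d /andP[dm /eqP ds]; rewrite c0 ?mulr0 // ds.
have := convolution n.+1 nN.
rewrite (bigID (fun d : {poly_N F} => size d == n.+2)) /= rest0 addr0 => sum0.
rewrite -[RHS]sum0; apply: eq_bigr => f /andP[fm /eqP fs].
by rewrite /c card_monic_multiples ?fs // subnn mulr1.
Qed.

End DivisorSums.

(** * Equidistribution *)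

Lemma squarefree_discriminant (F : finFieldType) (f : {poly F}) : f != 0 ->
  discriminant f != 0 -> squarefree f.
Proof. by move=> f0 d0; apply/squarefreeP => // g; exact: discriminant_neq0_sqr. Qed.

Theorem proposition2p5 (F : finFieldType) (q_odd : odd #|F|) (n : nat)
    (n_ge2 : (2 <= n)%N) :
  unif_prob (monic_squarefree F n) (fun f => residue (discriminant f)) =
  unif_prob (monic_squarefree F n) (fun f => nonresidue (discriminant f)).
Proof.
(* The event excludes discriminant 0, so it can be counted over all monic f. *)
have count (E : pred F) : (forall x, E x -> x != 0) ->
    #|[set f in monic_squarefree F n | E (discriminant f)]|%:R =
    \sum_(f : {poly_n.+1 F} | ((f : {poly F}) \is monic) && (size f == n.+1))
      (E (discriminant f))%:R :> int.
  move=> E0; rewrite -sum1_card natr_sum big_mkcond [RHS]big_mkcond /=.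
  apply: eq_bigr => f _; rewrite !inE -!andbA.
  have [fm|] //= := boolP (_ \is monic); have [fs|] //= := boolP (size _ == _).
  have [Ef|] := boolP (E _); last by rewrite andbF.
  by rewrite squarefree_discriminant ?E0 ?monic_neq0.
rewrite /unif_prob; congr (_%:R / _); apply/eqP; rewrite -(eqr_nat int).
rewrite !count => [|x /andP[]//|x /andP[]//].
rewrite -subr_eq0 -sumrB.
have := @sum_pellet F n.+1 n q_odd; rewrite n_ge2 ltnSn => /(_ isT).
rewrite (eq_bigr (fun f : {poly_n.+1 F} =>
  (-1) ^+ n * quadratic_char (discriminant f))); last first.
  by move=> f /andP[_ /eqP fs]; rewrite /pellet fs.
by rewrite -mulr_sumr => /eqP; rewrite mulf_eq0 signr_eq0.
Qed.
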